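(* Let $\mathcal{X}$ be a Banach space and let $T$ be a weakly quasistable operator on $\mathcal{X}$. Then either (a) $T$ is power bounded, or (b$_1$) $T$ is noncoercive power unbounded. Moreover, if $T$ is a noncoercive power unbounded operator, then (b$_2$) for any vector $x_0\in\mathcal{X}$ such that $\sup_n\|T^nx_0\|=\infty$, every pair of subsequences of the positive integers, one a subsequence of coercivity of $T$ for $x_0$ and the other a subsequence of weak stability of $T$ for $x_0$, has a finite set of common entries.
   Context: An operator on a normed space $\mathcal{X}$ is a bounded linear transformation of $\mathcal{X}$ into itself; $\mathcal{X}^*$ is the dual of $\mathcal{X}$. A subsequence $\{n_j\}$ of the positive integers is a strictly increasing infinite sequence of positive integers, identified with its range (an infinite subset of $\mathbb{N}$). A subsequence $\{n_j\}$ of the positive integers is a subsequence of weak stability of $T$ for $x\in\mathcal{X}$ if $\lim_j|f(T^{n_j}x)|=0$ for every $f\in\mathcal{X}^*$. An operator $T$ is weakly quasistable if for each $x\in\mathcal{X}$ there exists at least one subsequence of weak stability $\{n_j\}=\{n_j(x)\}$ of $T$ for $x$ (it may depend on $x$ but does not depend on $f$). $T$ is power bounded if $\sup_n\|T^n\|<\infty$, and power unbounded otherwise. A power unbounded operator $T$ is coercive if there is a vector $x_0\in\mathcal{X}$ such that $\lim_n\|T^nx_0\|=\infty$; otherwise it is noncoercive. If $\sup_n\|T^nx_0\|=\infty$, a subsequence of coercivity of $T$ for $x_0$ is a subsequence $\{m_j\}$ of the positive integers such that $\lim_j\|T^{m_j}x_0\|=\infty$. *)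

(* Defs.v *)
From mathcomp Require Import all_boot all_order all_algebra.
From mathcomp Require Import all_classical all_reals all_analysis.
From mathcomp Require Import complex.

Set Implicit Arguments.
Unset Strict Implicit.
Unset Printing Implicit Defensive.

Import Order.TTheory GRing.Theory Num.Theory.
Import numFieldNormedType.Exports.

Local Open Scope classical_set_scope.
Local Open Scope ring_scope.

(* The scalar field of a normed space is the field of real numbers or the field
   of complex numbers; one development covers both. *)
Inductive scalar_kind := RealScalars | ComplexScalars.

Definition scalars (R : realType) (k : scalar_kind) : numFieldType :=
  match k with RealScalars => R : numFieldType | ComplexScalars => R[i] end.

(* The norm of a [normedModType K] takes its values in K.  For K = R[i] these
   values are nonnegative elements of R[i], hence have imaginary part 0, so that
   taking the real part loses nothing. *)
Definition real_part (R : realType) (k : scalar_kind) : scalars R k -> R :=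
  match k return scalars R k -> R with
  | RealScalars => fun z => z
  | ComplexScalars => fun z => complex.Re z
  end.

Definition rnorm (R : realType) (k : scalar_kind)
    (V : normedModType (scalars R k)) (x : V) : R := real_part `|x|.

Section operators.
Variables (R : realType) (k : scalar_kind).

Local Notation K := (scalars R k).

Definition bounded_linear (V W : normedModType K) (f : {linear V -> W}) : Prop :=
  exists M : R, forall x : V, rnorm (f x) <= M * rnorm x.

Definition opnorm (V W : normedModType K) (f : V -> W) : \bar R :=
  ereal_sup [set (rnorm (f x))%:E | x in [set x : V | rnorm x <= 1]].

Variables (X : normedModType K) (T : {linear X -> X}).

Definition power_bounded : Prop :=
  (ereal_sup (range (fun n : nat => opnorm (iter n T))) < +oo)%E.

Definition power_unbounded : Prop := ~ power_bounded.

Definition subseq_of_posints (n : nat -> nat) : Prop :=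
  increasing_seq n /\ forall j, (0 < n j)%N.

Definition weak_stability_subseq (x : X) (n : nat -> nat) : Prop :=
  subseq_of_posints n /\
  forall f : {linear X -> K^o}, bounded_linear f ->
    rnorm (f (iter (n j) T x)) @[j --> \oo] --> (0 : R).

Definition weakly_quasistable : Prop :=
  forall x : X, exists n : nat -> nat, weak_stability_subseq x n.

Definition coercive : Prop :=
  power_unbounded /\
  exists x0 : X, rnorm (iter n T x0) @[n --> \oo] --> +oo.

Definition noncoercive_power_unbounded : Prop :=
  power_unbounded /\ ~ coercive.

Definition unbounded_orbit (x0 : X) : Prop :=
  (ereal_sup (range (fun n : nat => (rnorm (iter n T x0))%:E)) = +oo)%E.

Definition coercivity_subseq (x0 : X) (m : nat -> nat) : Prop :=
  subseq_of_posints m /\ rnorm (iter (m j) T x0) @[j --> \oo] --> +oo.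

End operators.

(* Main.v *)
Require Import Defs.
From mathcomp Require Import all_boot all_order all_algebra.
From mathcomp Require Import all_classical all_reals all_analysis.
From HB Require Import structures.
From mathcomp Require Import complex ring lra.

(** The heart of the matter is that a weakly null sequence is norm bounded
    ([weakly_null_bounded]). Hence a vector [x0] whose orbit has a subsequence of
    weak stability satisfies [rnorm (iter (n j) T x0) <= M] along it. This is
    incompatible with [rnorm (iter n T x0)] tending to infinity, so a weakly
    quasistable operator is never coercive; and a subsequence of coercivity for
    [x0] eventually leaves the ball of radius [M], so it shares only finitely
    many entries with a subsequence of weak stability. Neither the completeness
    of the space nor the boundedness of the operator plays a role.

    Boundedness of weakly null sequences combines the Hahn-Banach theorem with
    the uniform boundedness principle on the dual. To treat both scalar fields
    at once, these are proved for the additive real functionals on an abelian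
    group equipped with a seminorm.

    - [hahn_banach]: a minimal sublinear functional is additive, and Zorn's
      lemma provides minimal ones. Minimizing below [tilt p x0] rather than
      below [p] forces the value [p x0] at [x0].
    - [uniform_boundedness]: were the points [y i] unbounded, a gliding hump
      would produce a functional bounded by [p] and unbounded on them. The
      functional is a pointwise limit, so no completeness of a dual space has
      to be established.
    - [bounded_linear_above]: an additive functional [u] bounded by the norm is
      real-linear, and over the complex numbers it is the real part of a
      bounded complex-linear functional. Hence the values of [u] along a weakly
      null sequence are bounded, as [uniform_boundedness] requires. *)

Set Implicit Arguments.
Unset Strict Implicit.
Unset Printing Implicit Defensive.

Import Order.TTheory GRing.Theory Num.Theory.
Import numFieldNormedType.Exports.

Local Open Scope classical_set_scope.
Local Open Scope ring_scope.

(** * Estimates on real numbers *)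

Section real_sequences.
Variable R : realType.

Lemma le0_of_mulrn_le (d C : R) : (forall n, d *+ n <= C) -> d <= 0.
Proof.
move=> H; rewrite leNgt; apply/negP => d0.
have := H (Num.truncn (C / d)).+1; apply/negP; rewrite -ltNge.
by rewrite -mulr_natr mulrC -ltr_pdivrMr// truncnS_gt.
Qed.

Lemma eq_of_dist_le_geometric (x y C : R) :
  (forall n, `|x - y| <= C * 3^-1 ^+ n) -> x = y.
Proof.
move=> H; apply/eqP; rewrite -subr_eq0 -normr_le0.
apply: (@le0_of_mulrn_le _ C) => n.
have h3 : 0 < (3 : R) ^+ n by rewrite exprn_gt0.
have := H n; rewrite exprVn ler_pdivlMr//; apply: le_trans.
rewrite -[leLHS]mulr_natr ler_wpM2l// -natrX ler_nat.
by rewrite ltnW// ltn_expl.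
Qed.

(** The radii [e n] dominate the tails of the telescoping sum of the steps of
    [a], so the intervals of center [a n] and radius [e n] are nested, and
    [l] is a point common to all of them. *)
Lemma limit_of_telescoping_steps (a e : nat -> R) :
  (forall n, 0 <= e n) -> (forall n, `|a n.+1 - a n| <= e n - e n.+1) ->
  exists l, forall n, `|l - a n| <= e n.
Proof.
move=> e0 H.
have inc : {homo (fun n => a n - e n) : n m / (n <= m)%N >-> n <= m}.
  by apply/nondecreasing_seqP => n; have := H n; rewrite ler_norml; lra.
have dec : {homo (fun n => a n + e n) : n m / (n <= m)%N >-> n >= m}.
  by apply/nonincreasing_seqP => n; have := H n; rewrite ler_norml; lra.
have sep n m : a n - e n <= a m + e m.
  have [nm|/ltnW mn] := leqP n m.
    by have := inc _ _ nm; have := e0 m; lra.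
  by have := dec _ _ mn; have := e0 n; lra.
pose L := [set a n - e n | n in [set: nat]].
exists (sup L) => n.
have l1 : a n - e n <= sup L.
  apply: ub_le_sup; last by exists n.
  by exists (a 0%N + e 0%N) => _ [m _ <-].
have l2 : sup L <= a n + e n.
  apply: ge_sup; first by exists (a 0%N - e 0%N); exists 0%N.
  by move=> _ [m _ <-].
by rewrite ler_norml; apply/andP; split; lra.
Qed.

End real_sequences.

(** * The Hahn-Banach theorem on abelian groups *)

Section hahn_banach.
Variables (R : realType) (V : zmodType).
Implicit Types (p q : V -> R) (x y z : V).

(** Sublinear functionals on an abelian group: subadditive, and homogeneous
    for the multiplication by natural numbers. *)
Definition sublinear q :=
  (forall x y, q (x + y) <= q x + q y) /\
  (forall x n, q (x *+ n) = q x *+ n).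

Lemma sublinearI q : (forall x y, q (x + y) <= q x + q y) -> q 0 <= 0 ->
  (forall x n, q x *+ n <= q (x *+ n)) -> sublinear q.
Proof.
move=> qD q0 qM; split=> // x n; apply/eqP; rewrite eq_le qM andbT.
elim: n => [|n IHn]; first by rewrite !mulr0n.
by rewrite !mulrS (le_trans (qD _ _))// lerD2l.
Qed.

Lemma sublinear0 q : sublinear q -> q 0 = 0.
Proof. by move=> [_ qM]; rewrite -(mulr0n 0) qM mulr0n. Qed.

Lemma sublinear_geN q x : sublinear q -> - q (- x) <= q x.
Proof.
move=> sq; have := sublinear0 sq; case: sq => qD _ q0.
by have := qD x (- x); rewrite subrr q0; lra.
Qed.

(** For a sublinear [q], the functional [tilt q x] is [q] pushed down in the
    direction [- x]: it is sublinear, lies below [q] and satisfies [tilt q x y <= q (y + x) - q x] and [tilt q x (- x) <= - q x]. *)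
Definition tilt q x y :=
  inf [set q (y + x *+ n) - q x *+ n | n in [set: nat]].

Lemma tilt_le q x y n : sublinear q -> tilt q x y <= q (y + x *+ n) - q x *+ n.
Proof.
move=> [qD qM]; apply: ge_inf; last by exists n.
exists (- q (- y)) => _ [m _ <-].
have := qD (- y) (y + x *+ m).
by rewrite addrA addNr add0r qM; lra.
Qed.

Lemma le_tilt q x y (c : R) :
  (forall n, c <= q (y + x *+ n) - q x *+ n) -> c <= tilt q x y.
Proof.
move=> H; apply: lb_le_inf; first by eexists; exists 0%N.
by move=> _ [m _ <-].
Qed.

Lemma tilt_le_self q x y : sublinear q -> tilt q x y <= q y.
Proof. by move=> /(tilt_le x y 0); rewrite !mulr0n addr0 subr0. Qed.

Lemma sublinear_tilt q x : sublinear q -> sublinear (tilt q x).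
Proof.
move=> sq; have [qD qM] := sq; apply: sublinearI => [y z||y k].
- rewrite -lerBlDr; apply: le_tilt => n.
  rewrite lerBlDr -lerBlDl; apply: le_tilt => m.
  have := tilt_le x (y + z) (n + m) sq.
  have := qD (y + x *+ n) (z + x *+ m).
  by rewrite addrACA -!mulrnDr mulrnDr; lra.
- by rewrite (le_trans (tilt_le_self _ _ sq))// sublinear0.
- apply: le_tilt => n; case: k => [|k].
    by rewrite !mulr0n add0r qM subrr.
  (* It remains to bound [q (k (y + n x))], [k] here standing for the successor
     [k.+1], by splitting [k n x] into [n x] and [(k - 1) n x]. *)
  have := tilt_le x y n sq; move=> /(ler_wMn2r k.+1)/le_trans; apply.
  rewrite mulrnBl -(qM (y + _)) mulrnDl -!mulrnA.
  rewrite (mulnS n k) mulrnDr addrA.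
  by have := qD (y *+ k.+1 + x *+ n) (x *+ (n * k)%N); rewrite qM mulrnDr; lra.
Qed.

(** The infimum of a chain of sublinear functionals below [p] is again one of
    them, so Zorn's lemma applies. *)
Lemma exists_minimal_sublinear p : sublinear p ->
  exists q, [/\ sublinear q, forall x, q x <= p x &
    forall r, sublinear r -> (forall x, r x <= q x) -> r = q].
Proof.
move=> sp.
pose T := {q : V -> R | sublinear q /\ forall x, q x <= p x}.
pose below (s t : T) := `[< forall x, sval t x <= sval s x >].
have [|||A Atot|t tmin] := @Zorn T below.
- by move=> t; apply/asboolP.
- move=> r s t /asboolP rs /asboolP st; apply/asboolP => x.
  exact: le_trans (st x) (rs x).
- move=> [s ps] [t pt] /asboolP /= st /asboolP /= ts; apply: eq_exist.
  by apply/funext => x; apply/le_anti; rewrite st ts.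
- have [[s0 As0]|A0] := pselect (A !=set0); last first.
    exists (exist _ p (conj sp (fun x => lexx (p x)))) => s As.
    by case: A0; exists s.
  pose m x := inf [set sval s x | s in A].
  have m_le s x : A s -> m x <= sval s x.
    move=> As; apply: ge_inf; last by exists s.
    exists (- p (- x)) => _ [r _ <-].
    have [sr rp] := svalP r.
    by have := sublinear_geN x sr; have := rp (- x); lra.
  have le_m x c : (forall s, A s -> c <= sval s x) -> c <= m x.
    move=> H; apply: lb_le_inf; first by exists (sval s0 x); exists s0.
    by move=> _ [r Ar <-]; exact: H.
  have sm : sublinear m.
    apply: sublinearI => [x y||x n].
    + rewrite -lerBlDr; apply: (le_m _) => s As.
      rewrite lerBlDr -lerBlDl; apply: (le_m _) => r Ar.
      have [/asboolP sr|/asboolP rs] := Atot _ _ As Ar.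
        have [[rD _] _] := svalP r.
        have := m_le _ (x + y) Ar; have := rD x y; have := sr x; lra.
      have [[sD _] _] := svalP s.
      have := m_le _ (x + y) As; have := sD x y; have := rs y; lra.
    + have [ss _] := svalP s0.
      by rewrite -(sublinear0 ss) m_le.
    + apply: (le_m _) => s As; have [[_ sM] _] := svalP s.
      by rewrite sM lerMn2r// m_le ?orbT.
  have mp x : m x <= p x.
    by have [_ sp0] := svalP s0; exact: le_trans (m_le _ _ As0) (sp0 x).
  exists (exist _ m (conj sm mp)) => s As.
  by apply/asboolP => x /=; exact: m_le.
- have [st tp] := svalP t.
  exists (sval t); split=> // r sr rt.
  have rp x : r x <= p x := le_trans (rt x) (tp x).
  have /tmin <-// : below t (exist _ r (conj sr rp)).
  exact/asboolP.
Qed.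

(** Minimality of [q] gives [tilt q x = q], so that [q y <= q (y + x) - q x]. *)
Lemma minimal_sublinear_additive q : sublinear q ->
  (forall r, sublinear r -> (forall x, r x <= q x) -> r = q) ->
  forall x y, q (x + y) = q x + q y.
Proof.
move=> sq qmin x y; apply/eqP; rewrite eq_le sq.1/=.
have qE : tilt q x = q.
  by apply: qmin; [exact: sublinear_tilt|move=> z; exact: tilt_le_self].
by have := tilt_le x y 1 sq; rewrite qE !mulr1n [y + x]addrC lerBrDl.
Qed.

(** Hahn-Banach theorem: a sublinear functional dominates an additive one that
    agrees with it at a given point. *)
Theorem hahn_banach p (x0 : V) : sublinear p ->
  exists u : {additive V -> R}, (forall x, u x <= p x) /\ u x0 = p x0.
Proof.
move=> sp.
have [q [sq qp qmin]] := exists_minimal_sublinear (sublinear_tilt x0 sp).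
have qD := minimal_sublinear_additive sq qmin.
have q0 := sublinear0 sq.
have nq : nmod_morphism q by split.
pose u : {additive V -> R} := HB.pack q (GRing.isNmodMorphism.Build _ _ q nq).
have up x : u x <= p x := le_trans (qp x) (tilt_le_self x0 x sp).
exists u; split=> //; apply/le_anti; rewrite up/=.
have : u (- x0) <= - p x0.
  apply: le_trans (qp _) _; apply: le_trans (tilt_le _ _ 1 sp) _.
  by rewrite !mulr1n addNr sublinear0// sub0r.
by rewrite raddfN lerN2.
Qed.

End hahn_banach.

(** * Uniform boundedness for additive functionals *)

Section uniform_boundedness.
Variables (R : realType) (V : zmodType) (p : V -> R).
Hypotheses (sp : sublinear p) (pN : forall x, p (- x) = p x).

Lemma seminorm_ge0 x : 0 <= p x.
Proof. by have := sublinear_geN x sp; rewrite pN; lra. Qed.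

Lemma exists_norming_functional (x0 : V) :
  exists u : {additive V -> R}, (forall x, `|u x| <= p x) /\ u x0 = p x0.
Proof.
have [u [up ux0]] := hahn_banach x0 sp.
exists u; split=> // x; rewrite ler_norml up andbT.
by have := up (- x); rewrite pN raddfN; lra.
Qed.

(** Gliding hump: [u] is a signed sum of norming functionals with weights
    [3^-(n+1)], the signs being chosen one after the other so that, at its own
    norming point, each term reinforces the sum of the previous ones. *)
Theorem uniform_boundedness (I : Type) (y : I -> V) :
  (forall u : {additive V -> R}, (forall x, `|u x| <= p x) ->
     exists M, forall i, `|u (y i)| <= M) ->
  exists M, forall i, p (y i) <= M.
Proof.
move=> wb; apply: contrapT => /forallNP unb.
(* The factor [2 * 3 ^ (n + 1)] offsets the weight of the [n]-th term and the
   loss of half of it to the subsequent ones. *)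
have /choice[z zP] (n : nat) :
    exists i, n%:R * (2 * 3 ^+ n.+1) < p (y i).
  have /existsNP[i /negP] := unb (n%:R * (2 * 3 ^+ n.+1)).
  by rewrite -ltNge; exists i.
have /choice[g gP] (n : nat) := exists_norming_functional (y (z n)).
pose w n : R := 3^-1 ^+ n.
have w0 n : 0 < w n by rewrite exprn_gt0.
have wS n : w n.+1 = w n / 3 by rewrite /w exprSr.
(* [f n] is the partial sum of the first [n] terms. *)
pose f := fix f n : V -> R := if n is n'.+1 then
  (fun x => f n' x + (if 0 <= f n' (y (z n')) then 1 else -1) * w n'.+1 * g n' x)
  else (fun=> 0).
have f_add n x x' : f n (x + x') = f n x + f n x'.
  elim: n => [|n IHn] /=; first by rewrite addr0.
  by rewrite IHn raddfD; ring.
have f_step n x : `|f n.+1 x - f n x| <= w n.+1 * p x.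
  rewrite /= addrC addKr !normrM [`|w _|]ger0_norm ?(ltW (w0 _))//.
  have -> : `|if 0 <= f n (y (z n)) then 1 else -1| = 1 :> R.
    by case: ifP; rewrite ?normrN normr1.
  by rewrite mul1r ler_pM2l// (gP n).1.
have f_hump n : w n.+1 * p (y (z n)) <= `|f n.+1 (y (z n))|.
  rewrite /= (gP n).2.
  have : 0 <= w n.+1 * p (y (z n)) by rewrite mulr_ge0 ?seminorm_ge0// ltW.
  case: ifPn => [h h0|]; first by rewrite ger0_norm; lra.
  by rewrite -ltNge => h h0; rewrite ler0_norm; lra.
have /choice[F FP] x : exists l, forall n, `|l - f n x| <= w n / 2 * p x.
  apply: limit_of_telescoping_steps => n.
    by rewrite !mulr_ge0 ?seminorm_ge0// ltW.
  by apply: le_trans (f_step n x) _; rewrite !wS; lra.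
have FD x x' : F (x + x') = F x + F x'.
  apply: (@eq_of_dist_le_geometric _ _ _ ((p (x + x') + p x + p x') / 2)) => n.
  rewrite -/(w n).
  have := FP (x + x') n; have := FP x n; have := FP x' n; rewrite f_add.
  by rewrite !ler_norml; lra.
have F0 : F 0 = 0 by apply: (addrI (F 0)); rewrite -FD !addr0.
have nF : nmod_morphism F by split.
pose u : {additive V -> R} := HB.pack F (GRing.isNmodMorphism.Build _ _ F nF).
have up x : `|u x| <= p x.
  have := FP x 0%N; rewrite /= subr0 /w expr0 => /le_trans; apply.
  by have := seminorm_ge0 x; lra.
have [M uM] := wb u up.
have [n Mn] : exists n, M < n%:R by exists (Num.truncn M).+1; rewrite truncnS_gt.
have h1 : n%:R < w n.+1 / 2 * p (y (z n)).
  have := zP n; rewrite -ltr_pdivlMr ?mulr_gt0 ?exprn_gt0// => /lt_le_trans; apply.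
  by rewrite invfM /w exprVn; lra.
have := FP (y (z n)) n.+1; have := f_hump n; have := uM (z n).
rewrite /u/= -/(f n.+1 _) => h2 h3 h4.
have := ler_normB (F (y (z n))) (F (y (z n)) - f n.+1 (y (z n))).
rewrite opprB addrC subrK.
by have := seminorm_ge0 (y (z n)); move: (w0 n.+1) h1 h2 h3 h4; lra.
Qed.

End uniform_boundedness.

(** * From additive real functionals to linear functionals *)

Section scalars.
Variable R : realType.

(** The embedding of the real numbers in the scalar field. *)
Definition of_real (k : scalar_kind) : R -> scalars R k :=
  match k return R -> scalars R k with
  | RealScalars => fun r => r
  | ComplexScalars => fun r => (r%:C)%C
  end.

Lemma of_realB k (r s : R) : of_real k (r - s) = of_real k r - of_real k s.
Proof. by case: k => //=; rewrite rmorphB. Qed.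

Lemma of_realMn k (r : R) n : of_real k (r *+ n) = of_real k r *+ n.
Proof. by case: k => //=; rewrite raddfMn. Qed.

Lemma of_real_int k (m : int) : of_real k m%:~R = m%:~R.
Proof. by case: k => //=; rewrite rmorph_int. Qed.

Variable k : scalar_kind.
Variable X : normedModType (scalars R k).

Lemma rnormD (x y : X) : rnorm (x + y) <= rnorm x + rnorm y.
Proof.
rewrite /rnorm; have := ler_normD x y.
by case: k X x y => //= Y x y; rewrite lecE => /andP[_]; rewrite raddfD.
Qed.

Lemma rnormMn (x : X) n : rnorm (x *+ n) = rnorm x *+ n.
Proof.
rewrite /rnorm normrMn.
by case: k X x => //= Y x; rewrite raddfMn.
Qed.

Lemma rnormN (x : X) : rnorm (- x) = rnorm x.
Proof. by rewrite /rnorm normrN. Qed.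

Lemma rnorm_of_realZ (r : R) (x : X) : rnorm (of_real k r *: x) = `|r| * rnorm x.
Proof.
rewrite /rnorm normrZ.
case: k X x => //= Y x.
rewrite normc_def/= expr0n addr0 sqrtr_sqr.
by case: (`|x|) => a b /=; rewrite mul0r subr0.
Qed.

Lemma sublinear_rnorm : sublinear (@rnorm R k X).
Proof. by split; [exact: rnormD | exact: rnormMn]. Qed.

(** A bounded additive functional is real-linear: [u (r x) - r (u x)] is
    [n^-1] times the defect of [u] at the scalar [n r], which is bounded
    independently of [n] since [n r] is at distance at most 1 from an integer. *)
Lemma bounded_additive_homogeneous (u : {additive X -> R}) :
  (forall x, `|u x| <= rnorm x) ->
  forall (r : R) x, u (of_real k r *: x) = r * u x.
Proof.
move=> ub r x; apply/eqP; rewrite -subr_eq0 -normr_le0.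
apply: (@le0_of_mulrn_le _ _ (2 * rnorm x)) => n.
pose m := Num.floor (r *+ n); pose s := r *+ n - m%:~R.
have s1 : `|s| <= 1.
  have /andP[h1 h2] := floor_itv (r *+ n).
  by rewrite /s ler_norml; move: h1 h2; rewrite -/m intrD; lra.
have us : u (of_real k s *: x) = u (of_real k r *: x) *+ n - u x *~ m.
  by rewrite of_realB of_realMn of_real_int scalerBl -scalerMnl scaler_int
             raddfB raddfMn raddfMz.
have -> : `|u (of_real k r *: x) - r * u x| *+ n
          = `|u (of_real k s *: x) - s * u x|.
  rewrite -normrMn us /s; congr `|_|.
  by rewrite mulrnBl mulrBl mulrnAl -mulrzl; ring.
apply: le_trans (ler_normB _ _) _; rewrite mulr_natl mulr2n normrM.
have h1 := ub (of_real k s *: x); have h2 := ub x.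
rewrite lerD//.
  by apply: le_trans h1 _; rewrite rnorm_of_realZ ler_piMl// (le_trans _ h2).
by rewrite (le_trans _ h2)// ler_piMl.
Qed.

End scalars.

(** Over the complex numbers, a real functional [u] is the real part of the
    complex functional [x |-> u x - i (u (i x))]. *)
Lemma bounded_linear_above (R : realType) (k : scalar_kind)
    (X : normedModType (scalars R k)) (u : {additive X -> R}) :
  (forall x, `|u x| <= rnorm x) ->
  exists f : {linear X -> (scalars R k)^o},
    bounded_linear f /\ forall x, `|u x| <= rnorm (f x).
Proof.
move=> ub; have := bounded_additive_homogeneous ub.
case: k X u ub => /= X u ub uZ.
  have lu : linear (u : X -> R^o) by move=> a x y; rewrite raddfD uZ.
  pose f : {linear X -> R^o} := HB.pack (u : X -> R^o)
    (GRing.isLinear.Build _ _ _ _ (u : X -> R^o) lu).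
  exists f; split=> //; exists 1 => x; rewrite mul1r; exact: ub.
pose v (x : X) : R[i]^o := (u x +i* - u ('i%C *: x))%C.
have lv : linear v.
  move=> [a b] x y; rewrite /v.
  have cE (z : X) : (a +i* b)%C *: z = (a%:C)%C *: z + (b%:C)%C *: ('i%C *: z).
    by rewrite scalerA -scalerDl; congr (_ *: _); simpc.
  have iE : 'i%C *: ((a +i* b)%C *: x) = (a%:C)%C *: ('i%C *: x) - (b%:C)%C *: x.
    by rewrite !scalerA -scalerBl; congr (_ *: _); simpc.
  rewrite scalerDr iE cE !raddfD raddfN/= !uZ.
  by apply/eqP; rewrite eq_complex/=; apply/andP; split; apply/eqP; ring.
pose f : {linear X -> R[i]^o} := HB.pack v (GRing.isLinear.Build _ _ _ _ v lv).
exists f; split=> [|x]; last first.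
  by have := normc_ge_Re (v x); rewrite lecE => /andP[_].
exists 2 => x.
rewrite -[leLHS]/(complex.Re `|v x : R[i]|) normc_def /=.
change (rnorm x) with (complex.Re `|x|).
have ix : `|'i%C *: x| = `|x|.
  by rewrite normrZ normc_def/= expr0n expr1n add0r sqrtr1 mul1r.
have h1 := ub x; have := ub ('i%C *: x); rewrite ix => h2.
rewrite sqrrN -(real_normK (num_real (u x))) -(real_normK (num_real (u ('i%C *: x)))).
have := normr_ge0 (u x); have := normr_ge0 (u ('i%C *: x)).
set a := `|u x| in h1 *; set b := `|_| in h2 *; move=> b0 a0.
apply: (@le_trans _ _ (a + b)); last by rewrite mulr_natl mulr2n lerD.
rewrite -[leRHS]ger0_norm ?addr_ge0// -sqrtr_sqr ler_wsqrtr//.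
by nra.
Qed.

(** * Weak stability and coercivity *)

(** The values along [y] of every additive functional bounded by the norm are
    dominated by those of a bounded linear functional, which converge. *)
Lemma weakly_null_bounded (R : realType) (k : scalar_kind)
    (X : normedModType (scalars R k)) (y : nat -> X) :
  (forall f : {linear X -> (scalars R k)^o}, bounded_linear f ->
    rnorm (f (y j)) @[j --> \oo] --> (0 : R)) ->
  exists M, forall j, rnorm (y j) <= M.
Proof.
move=> wnull.
apply: uniform_boundedness => [||u ub]; [exact: sublinear_rnorm|exact: rnormN|].
have [f [bf uf]] := bounded_linear_above ub.
have /cvgP/cvg_seq_bounded/bounded_fun_has_ubound := wnull f bf.
by move=> [M fM]; exists M => j; apply: le_trans (uf _) (fM _ _); exists j.
Qed.

Lemma weakly_stable_orbit_bounded (R : realType) (k : scalar_kind)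
    (X : normedModType (scalars R k)) (T : {linear X -> X}) (x : X)
    (n : nat -> nat) :
  weak_stability_subseq T x n -> exists M, forall j, rnorm (iter (n j) T x) <= M.
Proof. by move=> [_ /weakly_null_bounded]. Qed.

Theorem theorem4p3 (R : realType) (k : scalar_kind)
    (X : completeNormedModType (scalars R k)) (T : {linear X -> X})
    (T_bounded : bounded_linear T) (T_wqs : weakly_quasistable T) :
  (power_bounded T \/ noncoercive_power_unbounded T) /\
  (noncoercive_power_unbounded T ->
   forall x0 : X, unbounded_orbit T x0 ->
   forall m n : nat -> nat,
     coercivity_subseq T x0 m -> weak_stability_subseq T x0 n ->
     finite_set (range m `&` range n)).
Proof.
split.
  have [|unb] := pselect (power_bounded T); [by left|right; split=> //].
  move=> [_ [x0 /cvgryPgt div]].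
  have [n st] := T_wqs x0.
  have [M leM] := weakly_stable_orbit_bounded st.
  have [[n_inc _] _] := st.
  have [N _ gtM] := div M.
  have le_n j : (j <= n j)%N.
    elim: j => // j /leq_ltn_trans; apply.
    by rewrite ltnNge -leEnat n_inc -ltnNge.
  by have := gtM _ (le_n N); apply/negP; rewrite -leNgt leM.
move=> _ x0 _ m n [_ /cvgryPgt div] /weakly_stable_orbit_bounded[M leM].
have [N _ gtM] := div M.
(* A common entry [m j = n i] has [j < N], as its orbit vector has norm at most [M]. *)
apply: (sub_finite_set _ (finite_image m (finite_II N))).
move=> _ [[j _ <-] [i _ nm]]; exists j => //=.
rewrite ltnNge; apply/negP => /gtM; apply/negP.
by rewrite -leNgt -nm leM.
Qed.
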